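(* Let $s\ge 2$, $1\le d\le s$ and $1\le r\le \binom{s}{d}$ be integers with $d+r-2<s$. If $f_1,\dots,f_r\in KV_{\le d}$ are polynomials of degree $d$ that are linearly independent over $K$, then $$|V_T(f_1,f_2,\dots,f_r)|\le (q-1)^s-(q-2)^{d-1}(q-1)^{s-d-r+1}\left[(q-1)^r-1\right].$$
   Context: $K=\mathbb{F}_q$ is the finite field with $q$ elements, $q$ a power of a prime, and $S=K[t_1,\dots,t_s]$. A monomial $t_1^{a_1}\cdots t_s^{a_s}$ is square-free if all $a_i\in\{0,1\}$; a polynomial is square-free if all its monomials are square-free. $KV_{\le d}$ is the $K$-span of all square-free monomials of $S$ of degree at most $d$. $T=(\mathbb{F}_q^* )^s$ is the affine torus, and $V_T(f_1,\dots,f_r)$ is the set of common zeros of $f_1,\dots,f_r$ in $T$. ''Degree'' means total degree. *)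

(* Defs.v *)
From mathcomp Require Import all_boot all_order all_algebra.
From mathcomp Require Import mpoly.

Set Implicit Arguments.
Unset Strict Implicit.
Unset Printing Implicit Defensive.

Import GRing.Theory Num.Theory.

Local Open Scope ring_scope.

Definition sqfree_mnm (s : nat) (m : 'X_{1..s}) : bool :=
  [forall i : 'I_s, (m i <= 1)%N].

(* 'X_{1..s < d.+1} is the finite type of monomials of total degree < d.+1. *)
Definition KVle (K : fieldType) (s d : nat) (f : {mpoly K[s]}) : Prop :=
  exists c : 'X_{1..s < d.+1} -> K,
    f = \sum_(m : 'X_{1..s < d.+1} | sqfree_mnm m) c m *: 'X_[m].

(* msize is 1 + the total degree, and is 0 for the zero polynomial. *)
Definition has_tdegree (K : fieldType) (s d : nat) (f : {mpoly K[s]}) : Prop :=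
  msize f = d.+1.

(* {mpoly K[s]} is not a vectType, so vector.v's [free] does not apply. *)
Definition lin_indep (K : fieldType) (V : lmodType K) (r : nat)
    (v : 'I_r -> V) : Prop :=
  forall c : 'I_r -> K, \sum_(i < r) c i *: v i = 0 -> forall i, c i = 0.

Definition torus (K : finFieldType) (s : nat) : {set {ffun 'I_s -> K}} :=
  [set x : {ffun 'I_s -> K} | [forall i, x i != 0]].

Definition VT (K : finFieldType) (s r : nat) (f : 'I_r -> {mpoly K[s]}) :
    {set {ffun 'I_s -> K}} :=
  [set x : {ffun 'I_s -> K} in torus K s | [forall j, (f j).@[x] == 0]].

(* Main.v *)
(* Square-free polynomials are encoded by their coefficient functions on sets
   of variables. For a space W of them, let supp W be the set of torus points at
   which some element of W does not vanish. For a variable t_i occurring in W,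
   let W0 be the subspace free of t_i and W1 the image of W under d/dt_i, so that
   dim W = dim W0 + dim W1. On a line parallel to the i-th axis, a nonvanishing
   element of W0 puts all q - 1 torus points in supp W, and a nonvanishing
   element of W1, being the slope of an affine function, at least q - 2. Hence
     (q - 1) |supp W| >= (q - 2) |supp W1| + |supp W0|,
   and the bound follows by induction on the degree and the dimension. *)
Require Import Defs.
From HB Require Import structures.
From mathcomp Require Import all_boot all_order all_algebra.
From mathcomp Require Import mpoly.
From mathcomp Require Import zify ring.

Set Implicit Arguments.
Unset Strict Implicit.
Unset Printing Implicit Defensive.

Import Order.TTheory GRing.Theory Num.Theory.

Local Open Scope ring_scope.

(** * Evaluation and derivation of square-free polynomials *)

Section SquareFree.

Variables (K : finFieldType) (n : nat).

(** Values in [K^o] make [sqf] a finite-dimensional vector space, so that [\dim] applies to its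
    subspaces. *)
Local Notation sqf := {ffun {set 'I_n} -> K^o}.

Definition sqf_eval (x : 'I_n -> K) (v : sqf) : K^o :=
  \sum_(A : {set 'I_n}) v A * \prod_(i in A) x i.

Definition sqf_deriv (i : 'I_n) (v : sqf) : sqf :=
  [ffun A : {set 'I_n} => if i \in A then 0 else v (i |: A)].

Lemma sqf_eval_is_linear x : linear (sqf_eval x).
Proof.
move=> a u v; rewrite /sqf_eval scaler_sumr -big_split /=.
by apply: eq_bigr => A _; rewrite !ffunE mulrDl -scalerAl.
Qed.

HB.instance Definition _ x :=
  GRing.isLinear.Build K sqf K^o _ (sqf_eval x) (sqf_eval_is_linear x).

Lemma sqf_deriv_is_linear i : linear (sqf_deriv i).
Proof.
move=> a u v; apply/ffunP => A; rewrite !ffunE.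
by case: ifP => // _; rewrite scaler0 addr0.
Qed.

HB.instance Definition _ i :=
  GRing.isLinear.Build K sqf sqf _ (sqf_deriv i) (sqf_deriv_is_linear i).

Definition upd (i : 'I_n) (x : {ffun 'I_n -> K}) (a : K) : {ffun 'I_n -> K} :=
  [ffun j => if j == i then a else x j].

(** Sets avoiding [i] do not see the new coordinate and sets containing [i] contribute one factor
    [a]: along the line the value is affine in [a], with the derivative as slope. *)
Lemma sqf_eval_upd i x a v :
  sqf_eval (upd i x a) v =
  \sum_(A : {set 'I_n} | i \notin A) v A * \prod_(j in A) x j
  + a * sqf_eval x (sqf_deriv i v).
Proof.
rewrite /sqf_eval (bigID (fun A : {set 'I_n} => i \notin A)) /=; congr (_ + _).
  apply: eq_bigr => A niA; congr (_ * _); apply: eq_bigr => j jA.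
  by rewrite ffunE; case: eqP => // ji; rewrite -ji jA in niA.
rewrite [in RHS](bigID (fun A : {set 'I_n} => i \notin A)) /=.
rewrite [X in _ * (_ + X)]big1 => [|A]; last first.
  by rewrite negbK => iA; rewrite ffunE iA mul0r.
rewrite addr0 mulr_sumr.
rewrite (reindex_onto (fun A => i |: A) (fun A => A :\ i)) /=; last first.
  by move=> A; rewrite negbK; exact: setD1K.
apply: eq_big => [A|A /andP[_ /eqP AE]].
  rewrite setU11 /=; apply/eqP/idP => [<-|niA]; first by rewrite !inE eqxx.
  by rewrite setU1K.
have niA : i \notin A by rewrite -AE !inE eqxx.
rewrite ffunE (negbTE niA) big_setU1 //= ffunE eqxx mulrCA; congr (_ * (_ * _)).
apply: eq_bigr => j jA; rewrite ffunE; case: eqP => // ji.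
by rewrite -ji jA in niA.
Qed.

(** * Supports and counting along axis-parallel lines *)

Definition degle (d : nat) (v : sqf) : Prop := forall A : {set 'I_n}, (d < #|A|)%N -> v A = 0.

Definition supp (W : {vspace sqf}) : {set {ffun 'I_n -> K}} :=
  [set x in torus K n | [exists v, (v \in W) && (sqf_eval x v != 0)]].

(** [ker_deriv] and [im_deriv] are the spaces W0 and W1 of the overview. *)
Definition ker_deriv i (W : {vspace sqf}) : {vspace sqf} :=
  (W :&: lker (linfun (sqf_deriv i)))%VS.

Definition im_deriv i (W : {vspace sqf}) : {vspace sqf} :=
  (linfun (sqf_deriv i) @: W)%VS.

Local Notation Q := (#|K|.-1).

Lemma card_units : #|[pred a : K | a != 0]| = Q.
Proof. by rewrite -(cardC1 (0 : K)); apply: eq_card => a; rewrite !inE. Qed.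

Lemma card_torus : #|torus K n| = (Q ^ n)%N.
Proof.
have -> : #|torus K n|
    = #|ffun_on [pred a : K | a != 0] : {pred {ffun 'I_n -> K}}|.
  apply: eq_card => x; rewrite inE; apply/forallP/ffun_onP => H i; exact: H.
by rewrite card_ffun_on card_units card_ord.
Qed.

Lemma upd_torus i x a : x \in torus K n -> a != 0 -> upd i x a \in torus K n.
Proof.
rewrite !inE => /forallP Hx a0; apply/forallP => j; rewrite ffunE.
by case: ifP.
Qed.

(* [(x, a) |-> (upd i x a, x i)] is an involution of torus * units. *)
Lemma sum_fibers i (S : {set {ffun 'I_n -> K}}) : S \subset torus K n ->
  (\sum_(x in torus K n) #|[pred a : K | (a != 0%R) && (upd i x a \in S)]|
   = Q * #|S|)%N.
Proof.
move=> /subsetP ST.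
pose h (p : {ffun 'I_n -> K} * K) := (upd i p.1 p.2, p.1 i).
have hK : involutive h.
  case=> x a; rewrite /h /= ffunE eqxx; congr (_, _).
  by apply/ffunP => j; rewrite !ffunE; case: eqP => // ->.
transitivity (\sum_(x in torus K n) \sum_(a | (a != 0%R) && (upd i x a \in S)) 1)%N.
  by apply: eq_bigr => x _; rewrite sum1_card.
rewrite pair_big_dep /= (reindex_inj (inv_inj hK)) /= -card_units mulnC.
rewrite -!sum1_card big_distrl /=.
rewrite (eq_bigl (fun p : {ffun 'I_n -> K} * K => (p.1 \in S) && (p.2 != 0))).
  rewrite -(pair_big (fun x => x \in S) (fun a : K => a != 0) (fun _ _ => 1%N)) /=.
  by apply: eq_bigr => x _; rewrite mul1n.
case=> x a /=; have := hK (x, a); rewrite /h /= => -[-> _].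
apply/and3P/andP => [[xaT xi0 xS]|[xS a0]].
  split=> //; move: xaT; rewrite inE => /forallP/(_ i).
  by rewrite ffunE eqxx.
have xT := ST _ xS; split=> //; first exact: upd_torus.
by move: xT; rewrite inE => /forallP.
Qed.

Lemma supp_fiber i W x : x \in torus K n ->
  (Q.-1 * (x \in supp (im_deriv i W)) + (x \in supp (ker_deriv i W))
   <= #|[pred a : K | (a != 0%R) && (upd i x a \in supp W)]|)%N.
Proof.
move=> xT.
have Q0 : (0 < Q)%N by rewrite -subn1 subn_gt0 card_finNzRing_gt1.
have suppU a v : a != 0 -> v \in W -> sqf_eval (upd i x a) v != 0 ->
    upd i x a \in supp W.
  move=> a0 vW vx; rewrite inE upd_torus //=.
  by apply/existsP; exists v; rewrite vW.
have [|_] := boolP (x \in supp (ker_deriv i W)).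
  rewrite inE => /andP[_ /existsP[v /andP[]]].
  rewrite memv_cap memv_ker lfunE /= => /andP[vW /eqP v0] vx.
  (* Since [v] is constant along the line, all [Q] of its torus points lie in [supp W], which
     suffices even if both indicators are 1. *)
  apply: (@leq_trans Q).
    rewrite addn1 -[leqRHS](prednK Q0) ltnS.
    by case: (_ \in _); rewrite ?muln1 ?muln0.
  rewrite -card_units; apply/subset_leq_card/subsetP => a; rewrite inE => a0.
  rewrite inE a0 /=; apply: (suppU a v) => //.
  have E b : sqf_eval (upd i x b) v = sqf_eval (upd i x (x i)) v.
    by rewrite !sqf_eval_upd v0 linear0 !mulr0.
  rewrite E; suff -> : upd i x (x i) = x by [].
  by apply/ffunP => j; rewrite ffunE; case: eqP => // ->.
have [|_] := boolP (x \in supp (im_deriv i W)); last by rewrite muln0.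
rewrite inE => /andP[_ /existsP[w /andP[/memv_imgP[v vW ->]]]].
rewrite lfunE /= => vx; rewrite muln1 addn0.
set c := \sum_(A : {set 'I_n} | i \notin A) v A * \prod_(j in A) x j.
set e := sqf_eval x (sqf_deriv i v) in vx.
have E a : sqf_eval (upd i x a) v = c + a * e := sqf_eval_upd i x a v.
(* The slope [e] is nonzero, so the only possible root is [- c / e]; at least [Q.-1] units
   remain. *)
have : (#|[pred a : K | a != 0%R]| <=
    #|[pred a : K | (a != 0%R) && (upd i x a \in supp W)]|
    + #|pred1 (- c / e)|)%N.
  rewrite -cardUI; apply: (leq_trans _ (leq_addr _ _)).
  apply/subset_leq_card/subsetP => a; rewrite inE => a0.
  have [->|ac] := eqVneq a (- c / e); apply/orP; first by right; rewrite inE.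
  left; rewrite inE a0; apply: (suppU a v) => //.
  rewrite E; apply: contra ac; rewrite addrC addr_eq0 => /eqP <-.
  by rewrite mulfK.
by rewrite card_units card1 addn1 -[X in (X <= _)%N](prednK Q0) ltnS.
Qed.

(** Summing the bound on lines over the torus meets each point of [supp W] exactly [Q] times. *)
Lemma supp_ineq i W :
  (Q.-1 * #|supp (im_deriv i W)| + #|supp (ker_deriv i W)| <= Q * #|supp W|)%N.
Proof.
have cardS W' : #|supp W'| = (\sum_(x in torus K n) (x \in supp W'))%N.
  rewrite -sum1_card big_mkcond [RHS]big_mkcond /=.
  by apply: eq_bigr => x _; rewrite [x \in supp _]inE; case: (x \in torus K n).
have ST : supp W \subset torus K n by apply/subsetP => x; rewrite inE => /andP[].
rewrite -(sum_fibers i ST) !cardS big_distrr -big_split /=.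
exact: leq_sum (fun x => @supp_fiber i W x).
Qed.

(** * Degree bounds and spaces of constants *)

Lemma degle_deriv d i v : degle d.+1 v -> degle d (sqf_deriv i v).
Proof.
move=> vd A dA; rewrite ffunE; case: ifP => // /negbT niA.
by apply: vd; rewrite cardsU1 niA.
Qed.

(** The coefficient at a nonempty [A] reappears in the derivative along any [i] in [A], at [A :\ i].
    No factor arises that could vanish in [K], as exponents are at most 1. *)
Lemma degle0_deriv v : (forall i, sqf_deriv i v = 0) -> degle 0 v.
Proof.
move=> v0 A; rewrite card_gt0 => /set0Pn[i iA].
have /ffunP/(_ (A :\ i)) := v0 i.
by rewrite !ffunE !inE eqxx /= setD1K.
Qed.

Lemma sqf_eval_degle0 x v : degle 0 v -> sqf_eval x v = v set0.
Proof.
move=> v0; rewrite /sqf_eval (bigD1 set0) //= big_set0 mulr1 big1 ?addr0 //.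
by move=> A A0; rewrite v0 ?mul0r // card_gt0.
Qed.

Lemma degle0_eq0 v : degle 0 v -> v set0 = 0 -> v = 0.
Proof.
move=> v0 vs; apply/ffunP => A; rewrite ffunE.
have [->//|A0] := eqVneq A set0.
by apply: v0; rewrite card_gt0.
Qed.

Lemma supp_degle0 (W : {vspace sqf}) : {in W, forall v, degle 0 v} -> (0 < \dim W)%N ->
  supp W = torus K n.
Proof.
move=> W0; rewrite lt0n dimv_eq0 => Wn0.
apply/setP => x; rewrite inE; case: (x \in torus K n) => //=.
apply/existsP; exists (vpick W); rewrite memv_pick /=.
have pW := memv_pick W.
rewrite sqf_eval_degle0; last exact: W0.
apply: contra Wn0 => /eqP p0; rewrite -vpick0; apply/eqP.
by apply: degle0_eq0 => //; apply: W0.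
Qed.

Lemma dim_degle0 (W : {vspace sqf}) : {in W, forall v, degle 0 v} -> (\dim W <= 1)%N.
Proof.
move=> W0; pose delta : sqf := [ffun A : {set 'I_n} => (A == set0)%:R].
have : (W <= <[delta]>)%VS.
  apply/subvP => v vW; apply/vlineP; exists (v set0); apply/ffunP => A.
  rewrite !ffunE; have [->|A0] := eqVneq A set0; first by rewrite [RHS]mulr1.
  by rewrite scaler0; apply: W0 => //; rewrite card_gt0.
by move=> /dimvS /leq_trans; apply; rewrite dim_vline; case: (_ != _).
Qed.

(** * The numerical bound and the double induction *)

(* [d] is the degree and [r] the dimension; with [u = 1 / (q - 1)] and [d > 0]
   this is the proportion of torus points off the zero locus of the products
   (t_1 - 1)...(t_(d-1) - 1)(t_(d-1+j) - 1), j = 1..r. *)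
Definition suppB (u : rat) (d r : nat) : rat :=
  if d is d'.+1 then (1 - u) ^+ d' * (1 - u ^+ r) else (0 < r)%:R.

(** Here [r0] and [r1] stand for the dimensions of the kernel and the image. For [d = 0] the image
    consists of constants, hence [r1 <= 1], and equality holds. *)
Lemma suppB_step (u : rat) d r0 r1 : 0 <= u <= 1 -> (d = 0 -> r1 <= 1)%N ->
    (0 < r1)%N ->
  suppB u d.+1 (r0 + r1) <= (1 - u) * suppB u d r1 + u * suppB u d.+1 r0.
Proof.
move=> /andP[u0 u1] + r1_gt0; case: d => [/(_ erefl) r1le|d _] /=.
  have -> : r1 = 1%N by apply/eqP; rewrite eqn_leq r1le.
  by rewrite addn1 exprS !expr0 !mul1r mulr1 mulrBr mulr1 addrA subrK.
case: r1 r1_gt0 => // r _.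
have a1 : 0 <= 1 - u ^+ r0 by rewrite subr_ge0 exprn_ile1.
have c1 : 0 <= 1 - u ^+ r by rewrite subr_ge0 exprn_ile1.
have pd : 0 <= (1 - u) ^+ d.+1 by rewrite exprn_ge0 // subr_ge0.
rewrite exprD [u ^+ r.+1]exprS -subr_ge0.
(* The difference of the two sides factors into nonnegative terms. *)
rewrite [X in 0 <= X](_ : _ =
  (1 - u) ^+ d.+1 * (u * ((1 - u ^+ r0) * (1 - u ^+ r)))).
  by rewrite !mulr_ge0.
by rewrite [(1 - u) ^+ d.+1]exprS; ring.
Qed.

(** Settles spaces of constants, whose support is empty or the whole torus, at any nominal
    degree. *)
Lemma suppB_le1 (u : rat) d r : 0 <= u <= 1 -> suppB u d r <= (0 < r)%:R.
Proof.
move=> /andP[u0 u1]; case: d => [|d] //=.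
case: r => [|r] /=; first by rewrite expr0 subrr mulr0.
rewrite mulr_ile1 ?exprn_ge0 ?exprn_ile1 ?subr_ge0 ?exprn_ile1 ?lerBlDr ?lerDl //.
exact: exprn_ge0.
Qed.

(** The outer induction on [d] serves the image, the inner one on the dimension serves the kernel.
    If every derivative vanishes on [W], only constants are left. *)
Lemma supp_ge d (W : {vspace sqf}) : {in W, forall v, degle d v} ->
  Q%:R ^+ n * suppB Q%:R^-1 d (\dim W) <= #|supp W|%:R.
Proof.
have Q0 : (0 < Q)%N by rewrite -subn1 subn_gt0 card_finNzRing_gt1.
have Qp : 0 < Q%:R :> rat by rewrite ltr0n.
set u : rat := Q%:R^-1.
have u01 : 0 <= u <= 1 by rewrite invr_ge0 ler0n invf_le1 // ler1n.
have const d' (W' : {vspace sqf}) : {in W', forall v, degle 0 v} ->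
    Q%:R ^+ n * suppB u d' (\dim W') <= #|supp W'|%:R.
  move=> W0; have := suppB_le1 d' (\dim W') u01.
  case: (posnP (\dim W')) => [_|dW] /= H.
    apply: le_trans (ler0n _ _).
    by rewrite pmulr_rle0 // exprn_gt0.
  by rewrite supp_degle0 // card_torus natrX ler_piMr // exprn_ge0 // ltW.
elim: d W => [|d IHd] W; first exact: const.
have [m] := ubnP (\dim W); elim: m W => // m IHm W dimW Wd.
have [/existsP[i iW]|/existsPn W0] :=
  boolP [exists i, im_deriv i W != 0%VS]; last first.
  apply: const => v vW; apply: degle0_deriv => i.
  have := W0 i; rewrite negbK => /eqP imW.
  have : linfun (sqf_deriv i) v \in im_deriv i W by apply: memv_img.
  by rewrite imW memv0 lfunE => /eqP.
have dimE : \dim W = (\dim (ker_deriv i W) + \dim (im_deriv i W))%N.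
  by rewrite limg_ker_dim.
have im_gt0 : (0 < \dim (im_deriv i W))%N by rewrite lt0n dimv_eq0.
have imd : {in im_deriv i W, forall v, degle d v}.
  by move=> w /memv_imgP[v vW ->]; rewrite lfunE; apply/degle_deriv/Wd.
have S1 := IHd _ imd.
have S0 : Q%:R ^+ n * suppB u d.+1 (\dim (ker_deriv i W))
    <= #|supp (ker_deriv i W)|%:R.
  (* The image is nonzero, so the kernel has smaller dimension than [W]. *)
  apply: IHm.
    by move: dimW; rewrite dimE ltnS; apply: leq_trans; rewrite -addn1 leq_add2l.
  by move=> v; rewrite memv_cap => /andP[vW _]; apply: Wd.
have Bstep : suppB u d.+1 (\dim W) <= (1 - u) * suppB u d (\dim (im_deriv i W))
    + u * suppB u d.+1 (\dim (ker_deriv i W)).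
  rewrite dimE; apply: suppB_step => // d0; apply: dim_degle0.
  by rewrite -d0.
have QE : Q%:R - 1 = Q.-1%:R :> rat.
  by rewrite -[in LHS](prednK Q0) -natr1 addrK.
have : (Q%:R - 1) * #|supp (im_deriv i W)|%:R + #|supp (ker_deriv i W)|%:R
    <= Q%:R * #|supp W|%:R :> rat.
  by rewrite QE -!natrM -natrD ler_nat supp_ineq.
(* With [u = 1 / Q], the weights [Q - 1] and 1 become [Q] times the weights [1 - u] and [u] of
   [Bstep]. *)
have -> : Q%:R - 1 = Q%:R * (1 - u) by rewrite mulrBr mulr1 divff ?gt_eqF.
set c1 := #|supp (im_deriv i W)|%:R in S1 *.
set c0 := #|supp (ker_deriv i W)|%:R in S0 *.
move=> H; rewrite -(ler_pM2l Qp); apply: le_trans H.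
have -> : c0 = Q%:R * (u * c0) by rewrite mulrA divff ?mul1r ?gt_eqF.
rewrite -mulrA -mulrDr ler_pM2l //.
move: u01 => /andP[u0 u1].
apply: (@le_trans _ _ ((1 - u) * (Q%:R ^+ n * suppB u d (\dim (im_deriv i W))) +
    u * (Q%:R ^+ n * suppB u d.+1 (\dim (ker_deriv i W))))).
  by rewrite !(mulrCA _ (Q%:R ^+ n)) -mulrDr ler_pM2l ?exprn_gt0.
by rewrite lerD // ler_wpM2l // subr_ge0.
Qed.

End SquareFree.

(** * Passage from multivariate polynomials to coefficient functions *)

Section ToMPoly.

Variables (K : finFieldType) (n : nat).

Local Notation sqf := {ffun {set 'I_n} -> K^o}.

Definition mnm_set (A : {set 'I_n}) : 'X_{1..n} :=
  [multinom nat_of_bool (i \in A) | i < n].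

Definition mnm_supp (m : 'X_{1..n}) : {set 'I_n} := [set i | m i != 0%N].

Lemma mnm_suppK m : sqfree_mnm m -> mnm_set (mnm_supp m) = m.
Proof.
move=> /forallP m1; apply/mnmP => i; rewrite mnmE inE.
by case: (m i) (m1 i) => [|[]].
Qed.

Lemma mdeg_mnm_set A : mdeg (mnm_set A) = #|A|.
Proof.
rewrite mdegE -sum1_card [RHS]big_mkcond /=.
by apply: eq_bigr => i _; rewrite mnmE; case: (i \in A).
Qed.

Definition sqf_mpoly (v : sqf) : {mpoly K[n]} :=
  \sum_(A : {set 'I_n}) (v A : K) *: 'X_[mnm_set A].

Lemma sqf_mpoly_is_linear : linear sqf_mpoly.
Proof.
move=> a u v; rewrite /sqf_mpoly scaler_sumr -big_split /=.
by apply: eq_bigr => A _; rewrite !ffunE scalerDl scalerA.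
Qed.

HB.instance Definition _ :=
  GRing.isLinear.Build K sqf {mpoly K[n]} _ sqf_mpoly sqf_mpoly_is_linear.

Lemma meval_sqf_mpoly (x : 'I_n -> K) v : (sqf_mpoly v).@[x] = sqf_eval x v.
Proof.
rewrite /sqf_mpoly /sqf_eval raddf_sum /=; apply: eq_bigr => A _.
rewrite mevalZ mevalX; congr (_ * _); rewrite [RHS]big_mkcond /=.
by apply: eq_bigr => i _; rewrite mnmE; case: (i \in A).
Qed.

Lemma KVle_sqf d (f : {mpoly K[n]}) :
  KVle d f -> exists v, degle d v /\ f = sqf_mpoly v.
Proof.
case=> c ->.
(* A square-free monomial is determined by its support, so the sum has at most one term; it is empty
   when [A] has more than [d] elements. *)
exists [ffun A =>
  \sum_(m : 'X_{1..n < d.+1} | sqfree_mnm m && (mnm_supp m == A)) c m].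
split=> [A dA|].
  rewrite ffunE big1 // => m /andP[mS /eqP mA].
  have := bmdeg m; rewrite -{1}(mnm_suppK mS) mdeg_mnm_set mA ltnS.
  by rewrite leqNgt dA.
rewrite (partition_big (fun m : 'X_{1..n < d.+1} => mnm_supp m) predT) //=.
apply: eq_bigr => A _; rewrite ffunE scaler_suml.
by apply: eq_bigr => m /andP[mS /eqP <-]; rewrite mnm_suppK.
Qed.

End ToMPoly.

(** * The bound on common zeros in the torus *)

(* The bound is stated in int; since d + r <= s + 1, the truncated exponent
   s.+1 - (d + r) is the true value of s - d - r + 1. *)
Theorem theorem3p7 (K : finFieldType) (q s d r : nat) (hq : #|K| = q)
    (hs : (2 <= s)%N) (hd : (1 <= d <= s)%N) (hr : (1 <= r <= 'C(s, d))%N)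
    (hdr : (d + r - 2 < s)%N)
    (f : 'I_r -> {mpoly K[s]})
    (hf : forall i, KVle d (f i))
    (hdeg : forall i, has_tdegree d (f i))
    (hfree : lin_indep f) :
  (#|VT f|%:Z <=
     (q%:Z - 1) ^+ s
     - (q%:Z - 2) ^+ (d - 1) * (q%:Z - 1) ^+ (s.+1 - (d + r))
       * ((q%:Z - 1) ^+ r - 1))%R.
Proof.
have [v vP] := fin_all_exists (fun i => KVle_sqf (hf i)).
pose X := [tuple v i | i < r]; pose W := <<X>>%VS.
have Xi (i : 'I_r) : X`_i = v i by rewrite -tnth_nth tnth_mktuple.
have dimW : \dim W = r.
  (* A linear relation among the [v i] maps to one among the [f i]. *)
  apply/eqP; rewrite -[X in _ == X](size_tuple X); apply/freeP => c c0.
  apply: hfree; transitivity (sqf_mpoly (\sum_(i < r) c i *: v i)).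
    rewrite linear_sum; apply: eq_bigr => i _.
    by rewrite linearZ /=; case: (vP i) => _ ->.
  suff -> : \sum_(i < r) c i *: v i = 0 by exact: linear0.
  by rewrite -[RHS]c0; apply: eq_bigr => i _; rewrite Xi.
have coordW w : w \in W -> w = \sum_(i < r) coord X i w *: v i.
  by move=> /coord_span {1}->; apply: eq_bigr => i _; rewrite Xi.
have Wd : {in W, forall w, degle d w}.
  move=> w /coordW -> A dA; rewrite sum_ffunE big1 // => i _.
  by rewrite ffunE (proj1 (vP i)) // scaler0.
(* At a common zero of the [f i] every element of their span vanishes, so the two sets are
   disjoint. *)
have VTW : (#|VT f| + #|supp W| <= #|torus K s|)%N.
  have VTC : VT f \subset torus K s :\: supp W.
    apply/subsetP => x; rewrite inE => /andP[xT /forallP x0].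
    rewrite inE xT andbT inE xT /=; apply/existsPn => w; rewrite negb_and negbK.
    have [/coordW ->|//] := boolP (w \in W).
    rewrite linear_sum big1 //= => i _; rewrite linearZ /= -meval_sqf_mpoly.
    by have := x0 i; rewrite (proj2 (vP i)) => /eqP ->; rewrite scaler0.
  have suppT : supp W \subset torus K s.
    by apply/subsetP => x; rewrite inE => /andP[].
  rewrite -[leqRHS](subnK (subset_leq_card suppT)) leq_add2r.
  apply: leq_trans (subset_leq_card VTC) _.
  by rewrite cardsD (setIidPr suppT).
have := supp_ge Wd; rewrite dimW hq.
move: VTW; rewrite card_torus hq.
have : (1 < q)%N by rewrite -hq card_finNzRing_gt1.
(* From here [Q] is q - 2, whereas it was q - 1 for the supports. *)
case: q {hq} => [|[|Q]] // _ /=; rewrite -(ler_nat rat) natrD natrX.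
move: hr => /andP[r_gt0 _].
case: d hd hdr {hf hdeg vP Wd} => // d _ hdr VTW suppW.
(* The degree is now [d.+1]; since [r] is positive, the subtraction in [hdr] does not truncate. *)
have /subnKC sE : (d + r <= s)%N by lia.
have -> : (s.+1 - (d.+1 + r) = s - (d + r))%N by [].
move: (s - (d + r))%N #|VT f| #|supp W| sE VTW suppW => k N S <- VTW suppW.
rewrite subSS subn0; set a : rat := Q.+1%:R in VTW suppW.
have a0 : a != 0 by rewrite pnatr_eq0.
rewrite -(ler_int rat) !(rmorphB, rmorphM, rmorphXn) /=.
have -> : Q.+2%:~R = a + 1 by rewrite natr1.
rewrite addrK (_ : a + 1 - 2 = a - 1); last by ring.
rewrite lerBrDr; apply: le_trans VTW; rewrite lerD2l; apply: le_trans suppW.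
(* What remains is an identity: of [a ^+ (d + r + k)], the factor [a ^+ d] turns [1 - a^-1] into
   [a - 1], and [a ^+ r] turns [1 - a ^- r] into [a ^+ r - 1]. *)
have E1 : (a - 1) ^+ d = a ^+ d * (1 - a^-1) ^+ d.
  by rewrite -exprMn mulrBr mulr1 divff.
have E2 : a ^+ r - 1 = a ^+ r * (1 - a ^- r).
  by rewrite mulrBr mulr1 divff // expf_neq0.
rewrite /= exprVn E1 E2 !exprD le_eqVlt; apply/orP; left; apply/eqP.
by move: (a ^- r) (a^-1) => b c; ring.
Qed.
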